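(* Let $g\in\mathbb{N}$ and let $\tau$ be a symmetric complex $g\times g$ matrix with positive definite imaginary part. For all $a_k,b_k\in\mathbb{R}^g$ and $u_k\in\mathbb{C}^g$ ($k=1,2,3,4$), with Whittaker--Watson dual vectors $a_k',b_k',u_k'$ and Jacobi dual vectors $\tilde a_k,\tilde b_k,\tilde u_k$, the following identity holds: $$\prod_{k=1}^4\theta_{[a_k;\,b_k]}(u_k|\tau)-\prod_{k=1}^4\theta_{[a_k';\,b_k']}(u_k'|\tau)=2^{-g}\sum_{p,q\in\mathbb{Z}^g/2\mathbb{Z}^g}\big(1-e^{-\pi i\langle p,q\rangle}\big)\prod_{k=1}^4 e^{-\pi i\langle\tilde a_k,q\rangle}\theta_{[\tilde a_k+\frac{p}{2};\,\tilde b_k+\frac{q}{2}]}(\tilde u_k|\tau).$$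
   Context: Let $\langle x,y\rangle=\sum_j x_jy_j$ be the standard bilinear scalar product on $\mathbb{C}^g$, $i=\sqrt{-1}$. For $a,b\in\mathbb{R}^g$ and $u\in\mathbb{C}^g$, the $g$-dimensional theta function with characteristics $[a;b]$ is $$\theta_{[a;b]}(u|\tau)=\sum_{k\in\mathbb{Z}^g}\exp\{\pi i\langle\tau(k+a),k+a\rangle+2\pi i\langle k+a,u+b\rangle\}.$$ Sums over $\mathbb{Z}^g/2\mathbb{Z}^g$ are taken over any set of representatives, e.g. $\{0,1\}^g$ (the summands do not depend on the choice). For $x_1,x_2,x_3,x_4\in\mathbb{C}^g$, the Whittaker--Watson dual vectors are $$x_1'=\tfrac12(-x_1+x_2+x_3+x_4),\quad x_2'=\tfrac12(x_1-x_2+x_3+x_4),$$ $$x_3'=\tfrac12(x_1+x_2-x_3+x_4),\quad x_4'=\tfrac12(x_1+x_2+x_3-x_4),$$ and the Jacobi dual vectors are $$\tilde x_1=\tfrac12(x_1+x_2+x_3+x_4),\quad \tilde x_2=\tfrac12(x_1+x_2-x_3-x_4),$$ $$\tilde x_3=\tfrac12(x_1-x_2+x_3-x_4),\quad \tilde x_4=\tfrac12(x_1-x_2-x_3+x_4).$$ These are applied with $x=a$, $x=b$ and $x=u$. *)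

(* Defs.v *)
From mathcomp Require Import all_boot all_order all_algebra.
From mathcomp Require Import finmap.
From mathcomp Require Import all_classical all_reals all_analysis.
From mathcomp Require Import complex.
From mathcomp.analysis.showcase Require summability.

Set Implicit Arguments.
Unset Strict Implicit.
Unset Printing Implicit Defensive.

Import Order.TTheory GRing.Theory Num.Theory.
Import numFieldNormedType.Exports.

Local Open Scope ring_scope.
Local Open Scope complex_scope.

(* The libraries have no exponential on R[i]; this is Euler's formula. *)
Definition cexp (R : realType) (z : R[i]) : R[i] :=
  (expR (complex.Re z))%:C * (cos (complex.Im z) +i* sin (complex.Im z)).

Definition pi_i (R : realType) : R[i] := 0 +i* pi.

(* Bilinear, not Hermitian, also when K is the complex field. *)
Definition dotp (K : pzSemiRingType) (g : nat) (x y : 'cV[K]_g) : K :=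
  \sum_(j < g) x j 0 * y j 0.

Definition toC (R : realType) (g : nat) (x : 'cV[R]_g) : 'cV[R[i]]_g :=
  map_mx (fun r : R => r%:C) x.

Definition ofZ (K : pzRingType) (g : nat) (k : 'cV[int]_g) : 'cV[K]_g :=
  map_mx intr k.
Arguments ofZ K {g} k.

Definition posdef (K : numDomainType) (g : nat) (A : 'M[K]_g) : Prop :=
  forall x : 'cV[K]_g, x != 0 -> 0 < dotp (A *m x) x.

(* The series is summed unconditionally: summability.sum is the limit of the
   partial sums over the finite subsets of Z^g directed by inclusion.  The
   alias R[i]^o is the one carrying the normed module structure. *)
Definition theta (R : realType) (g : nat) (a b : 'cV[R]_g)
    (u : 'cV[R[i]]_g) (tau : 'M[R[i]]_g) : R[i] :=
  summability.sum (fun k : 'cV[int]_g =>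
    let ka := toC (ofZ R k + a) in
    cexp (pi_i R * dotp (tau *m ka) ka
          + 2 * pi_i R * dotp ka (u + toC b)) : (R[i])^o).

(* The vectors x_1, ..., x_4 are numbered 0, ..., 3 by 'I_4. *)
Definition ww_dual (K : unitRingType) (V : lmodType K) (x : 'I_4 -> V)
    (k : 'I_4) : V :=
  2^-1 *: tnth [tuple - x 0 + x 1 + x 2 + x 3;
                      x 0 - x 1 + x 2 + x 3;
                      x 0 + x 1 - x 2 + x 3;
                      x 0 + x 1 + x 2 - x 3] k.

Definition jacobi_dual (K : unitRingType) (V : lmodType K) (x : 'I_4 -> V)
    (k : 'I_4) : V :=
  2^-1 *: tnth [tuple x 0 + x 1 + x 2 + x 3;
                      x 0 + x 1 - x 2 - x 3;
                      x 0 - x 1 + x 2 - x 3;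
                      x 0 - x 1 - x 2 + x 3] k.

(* S meets every coset of 2Z^g in Z^g exactly once. *)
Definition representatives_mod2 (g : nat) (S : {fset 'cV[int]_g}) : Prop :=
  forall k : 'cV[int]_g,
    exists! s, s \in S /\ exists m : 'cV[int]_g, k = s + m *+ 2.

(* Main.v *)
Require Import Defs.
From mathcomp Require Import all_boot all_order all_algebra.
From mathcomp Require Import finmap.
From mathcomp Require Import all_classical all_reals all_analysis.
From mathcomp Require Import complex.
From mathcomp Require Import ring lra.
From mathcomp.analysis.showcase Require Import summability.

(** The matrix [A] of the Jacobi dual is a symmetric orthogonal involution, so
    the product of the four theta series, a sum over [N] in [(Z^g)^4], has the
    same terms as a sum over the dual vectors [A N].  These are exactly the
    [J + p/2] with [p] in [Z^g / 2 Z^g] and [J] in [(Z^g)^4] of even sum; the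
    evenness is detected by the characters [(-1)^<k, q>] of [Z^g / 2 Z^g],
    which yields Jacobi's identity
      [prod theta = 2^-g * sum_p sum_q (dual product)].
    The Jacobi duals of the Whittaker-Watson duals are the same vectors up to
    the sign of the last three.  By the parity of theta each sign change costs
    a factor [e^(- pi i <p, q>)], of square 1, so three of them cost a single
    one.  The result is the difference of the two instances of Jacobi's
    identity. *)

Set Implicit Arguments.
Unset Strict Implicit.
Unset Printing Implicit Defensive.

Import Order.TTheory GRing.Theory Num.Theory.
Import numFieldNormedType.Exports.

Local Open Scope ring_scope.
Local Open Scope complex_scope.

(** * Unconditional sums *)

#[local] Existing Instance totally_filter.

Lemma partial_sumE (I : choiceType) (V : zmodType) (f : I -> V) (A : {fset I}) :
  partial_sum f A = \sum_(i <- A) f i.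
Proof. by rewrite /partial_sum big_seq_fsetE. Qed.

Lemma big_fsetM (I J : choiceType) (V : nmodType) (F : I * J -> V)
    (A : {fset I}) (B : {fset J}) :
  \sum_(p <- (A `*` B)%fset) F p = \sum_(x <- A) \sum_(y <- B) F (x, y).
Proof.
transitivity (\sum_(p <- [seq (x, y) | x <- A, y <- B]) F p).
  2: by rewrite big_allpairs_dep.
apply: perm_big; apply: uniq_perm; rewrite ?fset_uniq//.
  apply: allpairs_uniq; rewrite ?fset_uniq// => -[x y] [x' y'] _ _ //.
move=> [x y]; rewrite in_fsetM /=; apply/andP/allpairsP => [[xA yB]|].
  by exists (x, y).
by move=> [[x' y'] [/= xA yB [-> ->]]].
Qed.

Lemma ler_sum_fsubset (K : numDomainType) (I : choiceType) (F : I -> K)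
    (A B : {fset I}) :
  (forall i, 0 <= F i) -> (A `<=` B)%fset -> \sum_(i <- A) F i <= \sum_(i <- B) F i.
Proof.
move=> F0 AB; rewrite [leRHS](bigID (mem A) xpredT)/= -[leLHS]addr0 lerD ?sumr_ge0//.
rewrite -[leRHS]big_filter le_eqVlt; apply/orP; left; apply/eqP.
apply: perm_big; apply: uniq_perm; rewrite ?filter_uniq ?fset_uniq// => i.
by rewrite mem_filter; apply/idP/andP => [iA|[]//]; split=> //; exact: (fsubsetP AB).
Qed.

Section HasSum.
Context {K : numFieldType} {V : normedModType K}.
Local Open Scope classical_set_scope.

(** [summability.sum] is a limit and has a default value on divergent families; this relation
    records convergence together with the value. *)
Definition has_sum (I : choiceType) (f : I -> V) (s : V) : Prop :=
  partial_sum f @ totally --> s.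

Lemma has_sum_sum (I : choiceType) (f : I -> V) (s : V) :
  has_sum f s -> summability.sum f = s.
Proof. by move=> fs; apply: cvg_lim => //; exact: norm_hausdorff. Qed.

Lemma has_sum_unique (I : choiceType) (f : I -> V) (s t : V) :
  has_sum f s -> has_sum f t -> s = t.
Proof. by move=> /has_sum_sum <- /has_sum_sum <-. Qed.

Lemma has_sum_ext (I : choiceType) (f g : I -> V) (s : V) :
  f =1 g -> has_sum f s -> has_sum g s.
Proof. by move=> /funext ->. Qed.

Lemma has_sumZ (I : choiceType) (c : K) (f : I -> V) (s : V) :
  has_sum f s -> has_sum (fun i => c *: f i) (c *: s).
Proof.
move=> fs; rewrite /has_sum.
rewrite (_ : partial_sum _ = c \*: partial_sum f); first exact: cvgZl_tmp.
by apply/funext => A; rewrite !partial_sumE /= partial_sumE scaler_sumr.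
Qed.

Lemma has_sum_big (I : choiceType) (J : Type) (r : seq J)
    (f : J -> I -> V) (s : J -> V) :
  (forall j, has_sum (f j) (s j)) ->
  has_sum (fun i => \sum_(j <- r) f j i) (\sum_(j <- r) s j).
Proof.
move=> fs; rewrite /has_sum.
rewrite (_ : partial_sum _ = fun A => \sum_(j <- r) partial_sum (f j) A).
  by apply: cvg_big => [|j _]; [exact: add_continuous | exact: fs].
apply/funext => A; rewrite partial_sumE exchange_big.
by apply: eq_bigr => j _; rewrite partial_sumE.
Qed.

(** The maps [phi] and [psi] need only be mutually inverse between the supports, so a series
    carrying an indicator can be moved to another index set. *)
Lemma has_sum_reindex (I J : choiceType) (f : I -> V) (g : J -> V)
    (phi : I -> J) (psi : J -> I) (s : V) :
  (forall i, f i != 0 -> g (phi i) = f i /\ psi (phi i) = i) ->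
  (forall j, g j != 0 -> f (psi j) = g j /\ phi (psi j) = j) ->
  has_sum f s -> has_sum g s.
Proof.
move=> fg gf fs U /fs [A0 _ A0U].
exists [fset phi i | i in A0]%fset => // B /= A0B.
(* [A] is the pullback of the support of [g] in [B], enlarged by [A0]. The enlargement does not
   change the sum: an element of [A0] with nonzero term has its image in [B]. *)
pose A := (A0 `|` [fset psi j | j in B & g j != 0])%fset.
have -> : (partial_sum g B = partial_sum f A); last first.
  by apply: A0U; rewrite /= fsubsetUl.
rewrite !partial_sumE.
rewrite (bigID (fun j => g j == 0)) [RHS](bigID (fun i => f i == 0)) /=.
rewrite big1 ?add0r => [|? /eqP //].
rewrite [X in _ = (X + _)%R]big1 ?add0r => [|? /eqP //].
rewrite -big_filter -[RHS]big_filter.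
transitivity (\sum_(i <- [seq psi j | j <- [seq j <- B | g j != 0]]) f i).
  rewrite big_map !big_filter; apply: eq_bigr => j /gf[-> _] //.
apply: perm_big; apply: uniq_perm.
- rewrite map_inj_in_uniq ?filter_uniq ?fset_uniq// => x y.
  rewrite !mem_filter => /andP[/gf[_ xK] _] /andP[/gf[_ yK] _] xy.
  by rewrite -xK -yK xy.
- by rewrite filter_uniq ?fset_uniq.
move=> i; rewrite mem_filter in_fsetU; apply/mapP/andP.
  move=> [j]; rewrite mem_filter => /andP[gj jB] ->; have [-> _] := gf _ gj.
  split=> //; apply/orP; right; apply/imfsetP; exists j => //=.
  by rewrite inE jB.
move=> [fi /orP[iA0|]].
  have [gi iK] := fg _ fi; exists (phi i) => //.
  rewrite mem_filter gi fi /=; apply: (fsubsetP A0B).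
  by apply/imfsetP; exists i.
move=> /imfsetP[j /=]; rewrite inE => /andP[jB gj] ->.
by exists j; rewrite // mem_filter gj jB.
Qed.

End HasSum.

(** * Absolutely summable families and their products *)

Section AbsSummable.
Context {R : realType}.
Local Open Scope classical_set_scope.

Definition abs_summable (I : choiceType) (f : I -> R[i]) : Prop :=
  exists B : R, forall A : {fset I}, \sum_(i <- A) `|f i| <= B%:C.

(** The partial sums increase with the finite set, so they converge to their supremum. *)
Lemma has_sum_real_ge0 (I : choiceType) (f : I -> R) (B : R) :
  (forall i, 0 <= f i) -> (forall A : {fset I}, \sum_(i <- A) f i <= B) ->
  exists s : R, has_sum (f : I -> R^o) s.
Proof.
move=> f0 fB; pose E := range (fun A : {fset I} => \sum_(i <- A) f i).
have supE : has_sup E.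
  split; first by exists (\sum_(i <- fset0%fset) f i); exists fset0%fset.
  by exists B => _ [A _ <-].
exists (sup E); apply/cvgrPdist_lt => e e0.
have [_ [A0 _ <-] A0e] := sup_adherent e0 supE.
exists A0 => // A /= A0A; rewrite partial_sumE.
have AE : \sum_(i <- A) f i <= sup E.
  by apply: sup_upper_bound => //; exists A.
rewrite ger0_norm ?subr_ge0// ltrBlDr -ltrBlDl (lt_le_trans A0e)//.
exact: ler_sum_fsubset.
Qed.

(** Write [f] as the difference of the nonnegative families [|f| + f] and [|f|], bounded by [2B] and
    [B]. *)
Lemma has_sum_real (I : choiceType) (f : I -> R) (B : R) :
  (forall A : {fset I}, \sum_(i <- A) `|f i| <= B) ->
  exists s : R, has_sum (f : I -> R^o) s.
Proof.
move=> fB.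
have [s1 s1P] : exists s : R, has_sum ((fun i => `|f i|) : I -> R^o) s.
  by apply: (@has_sum_real_ge0 _ _ B).
have [s2 s2P] : exists s : R, has_sum ((fun i => `|f i| + f i)%R : I -> R^o) s.
  apply: (@has_sum_real_ge0 _ _ (B + B)) => [i|A].
    by rewrite -lerBlDr sub0r -normrN ler_norm.
  rewrite big_split lerD//; apply: le_trans (fB A); apply: ler_sum => i _.
  exact: ler_norm.
exists (s2 - s1); rewrite /has_sum.
rewrite (_ : partial_sum _ = partial_sum ((fun i => `|f i| + f i)%R : I -> R^o) \-
    partial_sum ((fun i => `|f i|) : I -> R^o)); first exact: cvgB s2P s1P.
apply/funext => A; rewrite /= !partial_sumE -sumrB.
by apply: eq_bigr => i _; rewrite addrAC subrr add0r.
Qed.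

Lemma normC_Re_Im_le (z : R[i]) :
  (`|complex.Re z|%:C <= `|z|) * (`|complex.Im z|%:C <= `|z|) *
  (`|z| <= (`|complex.Re z| + `|complex.Im z|)%:C).
Proof.
rewrite normc_def !lecR -!sqrtr_sqr.
split; [split|]; rewrite ?ler_wsqrtr ?lerDl ?lerDr ?sqr_ge0//.
rewrite -[leRHS]ger0_norm ?addr_ge0 ?sqrtr_ge0// -sqrtr_sqr ler_wsqrtr//.
by rewrite sqrrD !sqr_sqrtr ?sqr_ge0// lerD2r lerDl mulrn_wge0 // mulr_ge0 ?sqrtr_ge0.
Qed.

Lemma abs_summable_has_sum (I : choiceType) (f : I -> R[i]) :
  abs_summable f -> exists s : R[i], has_sum (f : I -> R[i]^o) s.
Proof.
move=> [B fB].
have [s1 s1P] : exists s : R, has_sum ((fun i => complex.Re (f i)) : I -> R^o) s.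
  apply: (@has_sum_real _ _ B) => A; rewrite -lecR; apply: le_trans (fB A).
  by rewrite rmorph_sum; apply: ler_sum => i _; rewrite normC_Re_Im_le.
have [s2 s2P] : exists s : R, has_sum ((fun i => complex.Im (f i)) : I -> R^o) s.
  apply: (@has_sum_real _ _ B) => A; rewrite -lecR; apply: le_trans (fB A).
  by rewrite rmorph_sum; apply: ler_sum => i _; rewrite normC_Re_Im_le.
exists (s1 +i* s2); apply/cvgrPdist_lt => e e0.
(* In the order of [R[i]], a positive element has zero imaginary part. *)
have [r r0 ->] : exists2 r : R, 0 < r & e = r%:C.
  by case: e e0 => x y; rewrite ltcE /= => /andP[/eqP -> x0]; exists x.
have r20 : 0 < r / 2 by rewrite divr_gt0.
move/cvgrPdist_lt : s1P => /(_ _ r20) s1P.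
move/cvgrPdist_lt : s2P => /(_ _ r20) s2P.
apply: filterS2 s1P s2P => A; rewrite !partial_sumE => h1 h2.
apply: le_lt_trans (normC_Re_Im_le _).2 _; rewrite ltcR.
by rewrite [ltRHS]splitr !raddfB !raddf_sum ltrD//= sumrN.
Qed.

(** A finite set of pairs lies in the rectangle of its two projections, over which the sum of norms
    factors. *)
Lemma abs_summableM (I J : choiceType) (f : I -> R[i]) (g : J -> R[i]) :
  abs_summable f -> abs_summable g ->
  abs_summable (fun p : I * J => f p.1 * g p.2).
Proof.
move=> [B fB] [D gD]; exists (B * D) => A.
have D0 : 0 <= D%:C by apply: le_trans (gD fset0%fset); rewrite sumr_ge0.
have sub : (A `<=` [fset p.1 | p in A] `*` [fset p.2 | p in A])%fset.
  by apply/fsubsetP => p pA; rewrite in_fsetM !in_imfset.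
apply: le_trans (ler_sum_fsubset _ sub) _ => [//|].
under eq_bigr do rewrite normrM.
rewrite big_fsetM /=; under eq_bigr do rewrite -mulr_sumr.
by rewrite -mulr_suml rmorphM ler_pM// ?sumr_ge0.
Qed.

(** Absolute summability gives the product family some sum [v]. Partial sums over rectangles factor,
    so along rectangles they tend both to [v] and to [s * t]. *)
Lemma has_sumM (I J : choiceType) (f : I -> R[i]) (g : J -> R[i]) (s t : R[i]) :
  abs_summable f -> abs_summable g ->
  has_sum (f : I -> R[i]^o) s -> has_sum (g : J -> R[i]^o) t ->
  has_sum ((fun p : I * J => f p.1 * g p.2) : _ -> R[i]^o) (s * t).
Proof.
move=> fa ga fs gt; have [v hv] := abs_summable_has_sum (abs_summableM fa ga).
suff -> : s * t = v by [].
have prodF : ProperFilter (nbhs (@totally I, @totally J)) by exact: filter_prod_proper.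
(* Rectangles are cofinal: one contains [A0] as soon as its sides contain the projections of
   [A0]. *)
have fin : (fun A : {fset I} * {fset J} => A.1 `*` A.2)%fset @ (totally, totally)
    --> totally.
  move=> U [A0 _ A0U].
  exists ([set A | [fset p.1 | p in A0] `<=` A]%fset,
          [set B | [fset p.2 | p in A0] `<=` B]%fset).
    by split; [exists [fset p.1 | p in A0]%fset | exists [fset p.2 | p in A0]%fset].
  move=> [A B] /= [A1 B1]; apply: A0U; apply/fsubsetP => -[x y] xy /=.
  rewrite in_fsetM /= (fsubsetP A1) ?(fsubsetP B1)//.
    by apply/imfsetP; exists (x, y).
  by apply/imfsetP; exists (x, y).
have hv' := cvg_comp _ _ fin hv.
apply: (@cvg_unique _ (@norm_hausdorff _ R[i]^o)); last exact: hv'.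
  exact: fmap_proper_filter.
have -> : (partial_sum (fun p : I * J => f p.1 * g p.2)) \o (fun A => A.1 `*` A.2)%fset
  = (fun A => partial_sum f A.1 * partial_sum g A.2).
  apply/funext => -[A B]; rewrite /= !partial_sumE big_fsetM /= mulr_suml.
  by apply: eq_bigr => x _; rewrite mulr_sumr.
have fs' : (fun A : {fset I} * {fset J} => partial_sum (f : I -> R[i]^o) A.1) @
    (totally, totally) --> (s : R[i]^o).
  move=> U /fs fU; exists ([set A | U (partial_sum f A)], setT) => [|[A B] []//].
  by split => //; exact: filterT.
have gt' : (fun A : {fset I} * {fset J} => partial_sum (g : J -> R[i]^o) A.2) @
    (totally, totally) --> (t : R[i]^o).
  move=> U /gt gU; exists (setT, [set B | U (partial_sum g B)]) => [|[A B] []//].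
  by split => //; exact: filterT.
exact: (cvgM fs' gt').
Qed.

Lemma abs_summableZ (I : choiceType) (c : R[i]) (f : I -> R[i]) :
  abs_summable f -> abs_summable (fun i => c * f i).
Proof.
(* The square root is the modulus of [c], as an element of [R]. *)
move=> [B fB]; exists (Num.sqrt (complex.Re c ^+ 2 + complex.Im c ^+ 2) * B) => A.
under eq_bigr do rewrite normrM.
by rewrite -mulr_sumr rmorphM /= -normc_def ler_wpM2l.
Qed.

Lemma has_sum_mull (I : choiceType) (c : R[i]) (f : I -> R[i]) (s : R[i]) :
  has_sum (f : I -> R[i]^o) s -> has_sum ((fun i => c * f i) : I -> R[i]^o) (c * s).
Proof. exact: has_sumZ. Qed.

End AbsSummable.

(** * Gaussian bounds and summability over Z^g *)

(** The unit sphere is closed in a cube, hence compact, and the quadratic form attains a positive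
    minimum [c] there. Homogeneity of degree two extends the bound to all [x]. *)
Lemma posdef_coercive (R : realType) (g : nat) (Y : 'M[R]_g) :
  posdef Y ->
  exists2 c : R, 0 < c & forall x, c * dotp x x <= dotp (Y *m x) x.
Proof.
(* For [g = 0] the sphere is empty, but both sides vanish and any positive constant serves. *)
case: g Y => [Y _|g Y Ypos].
  by exists 1 => // x; rewrite /dotp !big_ord0 mulr0.
pose A := [set v : 'rV[R]_g.+1 | dotp v^T v^T = 1]%classic.
have dotpT (v : 'rV[R]_g.+1) : dotp v^T v^T = \sum_j v 0 j * v 0 j.
  by apply: eq_bigr => j _; rewrite !mxE.
have contM (p q : 'rV[R]_g.+1 -> R) :
    continuous p -> continuous q -> continuous (fun v => p v * q v).
  by move=> cp cq v; apply: (cvgM (cp v) (cq v)).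
have contS (p : 'I_g.+1 -> 'rV[R]_g.+1 -> R) :
    (forall j, continuous (p j)) -> continuous (fun v => \sum_j p j v).
  by move=> cp; apply: continuous_big => //; exact: add_continuous.
have coordP j : continuous (fun v : 'rV[R]_g.+1 => v 0 j) by exact: coord_continuous.
have qcont : continuous (fun v : 'rV[R]_g.+1 => dotp v^T v^T).
  under eq_fun do rewrite dotpT.
  by apply: (contS) => j; exact: (contM).
have fcont : continuous (fun v : 'rV[R]_g.+1 => dotp (Y *m v^T) v^T).
  rewrite (_ : (fun _ => _) =
    fun v : 'rV[R]_g.+1 => \sum_i (\sum_j Y i j * v 0 j) * v 0 i); last first.
    apply/funext => v; apply: eq_bigr => i _; rewrite !mxE; congr (_ * _).
    by apply: eq_bigr => j _; rewrite mxE.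
  apply: (contS) => i; apply: (contM) => //; apply: (contS) => j; apply: (contM) => //.
  exact: cst_continuous.
have Acompact : compact A.
  apply: (@subclosed_compact _ _
      [set v : 'rV[R]_g.+1 | forall i, `[-1, 1]%classic (v ord0 i)]%classic).
  - apply: (@preimage_closed _ _ (fun v : 'rV[R]_g.+1 => dotp v^T v^T) [set 1]%classic).
      by move=> v _; exact: qcont.
    exact: closed_eq.
  - have := @rV_compact R g.+1 (fun=> `[-1, 1]%classic).
    by apply=> _; exact: segment_compact.
  move=> v; rewrite /A /= dotpT => v1 i /=; rewrite in_itv /= -ler_norml.
  rewrite -(@ler_pXn2r _ 2) ?nnegrE// expr1n real_normK ?num_real// -v1.
  by rewrite (bigD1 i) //= expr2 lerDl sumr_ge0 // => j _; rewrite -expr2 sqr_ge0.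
have A0 : (A !=set0)%classic.
  exists (delta_mx 0 0); rewrite /A /= dotpT (bigD1 0) //= big1 ?mxE ?addr0 ?mulr1//.
  by move=> i i0; rewrite !mxE (negPf i0) mulr0.
have [v vA vmin] := compact_EVT_min A0 Acompact (continuous_subspaceT fcont).
have v1 : dotp v^T v^T = 1 by rewrite inE in vA.
have v0 : v^T != 0.
  apply/eqP => v0; move: v1; rewrite v0 /dotp big1 => [/esym/eqP|i _].
    by rewrite oner_eq0.
  by rewrite mxE mul0r.
exists (dotp (Y *m v^T) v^T) => [|x]; first exact: Ypos.
have [->|x0] := eqVneq x 0.
  suff d0 y : dotp y (0 : 'cV[R]_g.+1) = 0 by rewrite !d0 mulr0.
  by rewrite /dotp big1 // => i _; rewrite [X in _ * X]mxE mulr0.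
have q0 : 0 < dotp x x.
  rewrite lt_def sumr_ge0 ?andbT => [|i _]; last by rewrite -expr2 sqr_ge0.
  apply: contra x0; rewrite psumr_eq0 => [/allP x0|i _]; last by rewrite -expr2 sqr_ge0.
  apply/eqP/colP => i; rewrite mxE.
  by have := x0 i (mem_index_enum _); rewrite -expr2 sqrf_eq0 => /eqP.
pose r := Num.sqrt (dotp x x).
have r0 : r != 0 by rewrite gt_eqF // sqrtr_gt0.
have rE : dotp x x = r ^+ 2 by rewrite sqr_sqrtr // ltW.
have xE : x = r *: (r^-1 *: x) by rewrite scalerA divff // scale1r.
have dotpZ (s t : R) (y z : 'cV[R]_g.+1) : dotp (s *: y) (t *: z) = s * t * dotp y z.
  by rewrite /dotp mulr_sumr; apply: eq_bigr => i _; rewrite !mxE mulrACA.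
have /(vmin (r^-1 *: x)^T) : (r^-1 *: x)^T \in A.
  by rewrite inE /A /= trmxK dotpZ rE -expr2 -exprMn mulVf // expr1n.
rewrite trmxK -scalemxAr dotpZ -ler_pdivlMr // rE.
by rewrite mulrC -invfM -expr2.
Qed.

Section IntVectors.
Context {R : realType}.

(** Since [h] is injective on [A], the left side is a subsum of the right side. The coding [e] may
    repeat values, as it does below, where zero carries either sign. *)
Lemma sum_ffun_ge (S : finType) (T : choiceType) (F : T -> R) (e : S -> T)
    (h : T -> S) (A : {fset T}) :
  (forall k, 0 <= F k) -> {in A, cancel h e} ->
  \sum_(k <- A) F k <= \sum_(s : S) F (e s).
Proof.
move=> F0 hK.
rewrite (eq_big_seq (fun k => F (e (h k)))) => [|k kA]; last by rewrite hK.
rewrite -(big_map h xpredT (fun s => F (e s))) big_uniq /=; last first.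
  by rewrite map_inj_in_uniq ?fset_uniq// => x y xA yA /(congr1 e); rewrite !hK.
by rewrite [leRHS](bigID (mem (map h A))) /= lerDl sumr_ge0.
Qed.

Lemma geometric_sum_le (r : R) (N : nat) : 0 <= r < 1 ->
  \sum_(n < N) r ^+ n <= (1 - r)^-1.
Proof.
move=> /andP[r0 r1]; have r10 : 0 < 1 - r by rewrite subr_gt0.
rewrite -[leRHS]mul1r ler_pdivlMr // mulrC.
by rewrite -opprB mulNr -subrX1 opprB lerBlDr lerDl exprn_ge0.
Qed.

(** The finite set lies in a box, coded by the sign and absolute value of each entry. Over the box
    the sum of products is a product of [g] sums, each at most two geometric series. *)
Lemma sum_prod_geometric_le (g : nat) (r : R) (A : {fset 'cV[int]_g}) :
  0 <= r < 1 ->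
  \sum_(k <- A) \prod_j r ^+ `|k j 0%R|%N <= (2 * (1 - r)^-1) ^+ g.
Proof.
move=> r01; have /andP[r0 r1] := r01.
pose N := (\max_(k <- A) \max_j `|k j 0%R|)%N.
pose e (s : {ffun 'I_g -> bool * 'I_N.+1}) : 'cV[int]_g :=
  \col_j ((-1) ^+ (s j).1 * (s j).2%:Z).
pose h (k : 'cV[int]_g) : {ffun 'I_g -> bool * 'I_N.+1} :=
  [ffun j => (k j 0 < 0, inord `|k j 0%R|%N)].
have hK : {in A, cancel h e}.
  move=> k kA; apply/colP => j; rewrite !mxE ffunE /= inordK ?ltnS.
    by rewrite abszE -intEsign.
  apply: leq_trans (leq_bigmax_seq k kA isT).
  by apply: (leq_bigmax_seq j) => //; rewrite mem_index_enum.
have F0 (k : 'cV[int]_g) : 0 <= \prod_j r ^+ `|k j 0%R|%N.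
  by rewrite prodr_ge0 // => j _; rewrite exprn_ge0.
apply: le_trans (sum_ffun_ge F0 hK) _.
under eq_bigr => s _ do under eq_bigr => j _ do rewrite mxE abszMsign absz_nat.
rewrite -(bigA_distr_bigA (fun (j : 'I_g) (s : bool * 'I_N.+1) => r ^+ s.2)) /=.
rewrite prodr_const card_ord lerXn2r ?nnegrE//.
- by rewrite sumr_ge0 // => s _; rewrite exprn_ge0.
- by rewrite mulr_ge0 // invr_ge0 subr_ge0 ltW.
rewrite -(pair_bigA _ (fun (b : bool) (n : 'I_N.+1) => r ^+ n)) /=.
by rewrite big_bool /= mulr_natl mulr2n lerD ?geometric_sum_le.
Qed.

Lemma abs_summable_geometric (g : nat) (r D : R) (f : 'cV[int]_g -> R[i]) :
  0 <= r < 1 ->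
  (forall k, `|f k| <= (D * \prod_j r ^+ `|k j 0%R|%N)%:C) -> abs_summable f.
Proof.
move=> r01 fD; have D0 : 0 <= D.
  have := le_trans (normr_ge0 _) (fD 0); rewrite lecR big1 ?mulr1 // => j _.
  by rewrite mxE expr0.
exists (D * (2 * (1 - r)^-1) ^+ g) => A.
apply: le_trans (ler_sum _ (fun k _ => fD k)) _.
by rewrite -rmorph_sum lecR -mulr_sumr ler_wpM2l // sum_prod_geometric_le.
Qed.

End IntVectors.

(** * The complex exponential and its values at integer multiples of pi i *)

Section Cexp.
Context {R : realType}.
Implicit Types (z w : R[i]) (n : int).

Lemma cexpD z w : cexp (z + w) = cexp z * cexp w.
Proof.
rewrite /cexp !raddfD /= expRD cosD sinD rmorphM /= mulrACA; congr (_ * _).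
by apply/eqP; rewrite eq_complex /= ?eqxx ?[_ * cos (complex.Im w) + _]addrC ?eqxx.
Qed.

Lemma cexp0 : cexp 0 = 1 :> R[i].
Proof. by rewrite /cexp /= expR0 cos0 sin0 mul1r. Qed.

Lemma cexp_sum (I : Type) (r : seq I) (F : I -> R[i]) :
  cexp (\sum_(i <- r) F i) = \prod_(i <- r) cexp (F i).
Proof. by apply: (big_morph _ cexpD cexp0). Qed.

Lemma norm_cexp z : `|cexp z| = (expR (complex.Re z))%:C.
Proof.
rewrite normrM normc_def /= expr0n addr0 sqrtr_sqr ger0_norm ?expR_ge0//.
by rewrite normc_def /= cos2Dsin2 sqrtr1 mulr1.
Qed.

Lemma cexp_neq0 z : cexp z != 0.
Proof. by rewrite -normr_eq0 norm_cexp fmorph_eq0 gt_eqF // expR_gt0. Qed.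

Lemma cexp_pi_nat (n : nat) : cexp (pi_i R * n%:R) = (-1) ^+ n.
Proof.
elim: n => [|n IH]; first by rewrite mulr0 cexp0 expr0.
rewrite mulrSr mulrDr cexpD IH exprSr mulr1; congr (_ * _).
by rewrite /cexp /= expR0 cospi sinpi mul1r; apply/eqP; rewrite eq_complex /= oppr0 !eqxx.
Qed.

Lemma cexp_pi_int n : cexp (pi_i R * n%:~R) = (-1) ^+ `|n|%N.
Proof.
case: n => n; first exact: cexp_pi_nat.
(* For the integer [-(n+1)], multiply by the exponential of the opposite argument: both sides become
   1, the right one as an even power of -1. *)
apply: (mulIf (cexp_neq0 (pi_i R * n.+1%:R))).
rewrite -cexpD NegzE mulrNz mulrN addNr cexp0 cexp_pi_nat -exprD addnn.
by rewrite -signr_odd odd_double.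
Qed.

Lemma cexp_pi_even n : cexp (pi_i R * (2 * n)%:~R) = 1.
Proof. by rewrite cexp_pi_int abszM -signr_odd oddM. Qed.

End Cexp.

(** * Terms of the theta series and their decay *)

Section ThetaTerm.
Context {R : realType} {g : nat}.
Variable tau : 'M[R[i]]_g.
Implicit Types (x y : 'cV[R]_g) (w : 'cV[R[i]]_g).

(** The term of the series at [x = k + a] and [w = u + b]. Keeping these as two free arguments lets
    translations and dual transformations act on them directly. *)
Definition theta_term x w : R[i] :=
  cexp (pi_i R * dotp (tau *m toC x) (toC x) + 2 * pi_i R * dotp (toC x) w).

Lemma dotpE (K : comPzRingType) (A : 'M[K]_g) (x : 'cV[K]_g) :
  dotp (A *m x) x = \sum_i \sum_j A i j * x j 0 * x i 0.
Proof. by apply: eq_bigr => i _; rewrite mxE mulr_suml. Qed.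

Lemma Re_theta_exponent x w :
  complex.Re (pi_i R * dotp (tau *m toC x) (toC x) + 2 * pi_i R * dotp (toC x) w) =
  - pi * (dotp (map_mx (fun z : R[i] => complex.Im z) tau *m x) x
          + 2 * dotp x (map_mx (fun z : R[i] => complex.Im z) w)).
Proof.
have Re_pi z : complex.Re (pi_i R * z) = - pi * complex.Im z.
  by case: z => s t /=; rewrite mul0r add0r mulNr.
have ImZ (r : R) (z : R[i]) : complex.Im (r%:C * z) = r * complex.Im z.
  by case: z => s t /=; rewrite mul0r addr0.
rewrite raddfD /= -mulrA [2 * _]mulrCA !Re_pi -mulrDr; congr (_ * (_ + _)).
  rewrite !dotpE raddf_sum; apply: eq_bigr => i _; rewrite raddf_sum.
  apply: eq_bigr => j _; rewrite !mxE /= mulrC ImZ [_ * (x j 0)%:C]mulrC ImZ.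
  by ring.
rewrite -[2]/(2%:R) -(rmorph_nat (real_complex R)) ImZ; congr (_ * _).
by rewrite raddf_sum; apply: eq_bigr => j _; rewrite !mxE /= ImZ.
Qed.

(** This completes the square of [2c|t| - (|v| + 1)]; it trades Gaussian decay for the geometric
    decay of [e^(-|t|)]. *)
Lemma linear_le_square (c v t : R) : 0 < c ->
  - c * t ^+ 2 + v * t <= (`|v| + 1) ^+ 2 / (4 * c) - `|t|.
Proof.
move=> c0; have c4 : 0 < 4 * c by rewrite mulr_gt0.
have vt : v * t <= `|v| * `|t| by rewrite -normrM ler_norm.
rewrite -subr_ge0 -(pmulr_rge0 _ c4).
have -> : 4 * c * ((`|v| + 1) ^+ 2 / (4 * c) - `|t| - (- c * t ^+ 2 + v * t)) =
  (`|v| + 1) ^+ 2 - 4 * c * `|t| + 4 * c * c * t ^+ 2 - 4 * c * (v * t).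
  by field; rewrite gt_eqF.
rewrite -(real_normK (num_real t)).
have h : 4 * c * (v * t) <= 4 * c * (`|v| * `|t|) by rewrite ler_pM2l.
have := sqr_ge0 (2 * c * `|t| - (`|v| + 1)).
nra.
Qed.

(** Coercivity of the imaginary part of [tau] bounds the real exponent by a sum over coordinates of
    concave quadratics in [x j 0]. Each is at most a constant minus [|k j 0|], which gives a
    geometric bound of ratio [e^(-1)]. *)
Lemma theta_term_abs_summable (a : 'cV[R]_g) w :
  posdef (map_mx (fun z : R[i] => complex.Im z) tau) ->
  abs_summable (fun k : 'cV[int]_g => theta_term (ofZ R k + a) w).
Proof.
move=> /posdef_coercive[c c0 tauc].
pose v j := - (2 * pi) * complex.Im (w j 0).
have pi0 : 0 < pi :> R by exact: pi_gt0.
have pic0 : 0 < pi * c by rewrite mulr_gt0.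
(* The first summand comes from completing the square; [|a j 0|] pays for replacing
   [|k j 0 + a j 0|] by [|k j 0|]. *)
pose C j := (`|v j| + 1) ^+ 2 / (4 * (pi * c)) + `|a j 0|.
apply: (@abs_summable_geometric _ _ (expR (-1)) (expR (\sum_j C j))).
  by rewrite expR_ge0 -[ltRHS]expR0 ltr_expR ltrN10.
move=> k; rewrite norm_cexp lecR Re_theta_exponent.
under eq_bigr do rewrite -expRM_natl.
rewrite -expR_sum -expRD ler_expR; set x := _ + a.
apply: (@le_trans _ _ (\sum_j (- (pi * c) * x j 0 ^+ 2 + v j * x j 0))).
  rewrite big_split /= -!mulr_sumr.
  have -> : \sum_j x j 0 ^+ 2 = dotp x x by [].
  have -> : \sum_j v j * x j 0 =
      - pi * (2 * dotp x (map_mx (fun z : R[i] => complex.Im z) w)).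
    rewrite /dotp !mulr_sumr; apply: eq_bigr => j _; rewrite !mxE /v; ring.
  by rewrite [leLHS]mulrDr lerD2r !mulNr lerN2 -mulrA ler_pM2l.
rewrite -big_split /=; apply: ler_sum => j _.
apply: le_trans (linear_le_square _ _ pic0) _; rewrite -addrA lerD2l.
have -> : `|k j 0%R|%N%:R = `|x j 0 - a j 0| :> R.
  by rewrite [x _ _]mxE addrK mxE -intr_norm -abszE.
by have := ler_normB (x j 0) (a j 0); lra.
Qed.

End ThetaTerm.

(** * Characters of Z^g / 2 Z^g *)

Lemma mulz_mul2 (n : int) : n *+ 2 = n * 2%Z.
Proof. by rewrite -mulr_natr. Qed.

Section Parity.
Context {R : realType} {g : nat}.
Implicit Types (k m p q : 'cV[int]_g).

Definition even_vec k : bool := [forall j, (2 %| k j 0%R)%Z].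
Definition half_vec k : 'cV[int]_g := map_mx (fun n => n %/ 2)%Z k.

Lemma half_vecK k : even_vec k -> half_vec k *+ 2 = k.
Proof.
by move=> /forallP k2; apply/colP => j; rewrite mulmxnE mxE mulz_mul2 divzK.
Qed.

Lemma mul2_half_vec k : half_vec (k *+ 2) = k.
Proof. by apply/colP => j; rewrite mxE mulmxnE mulz_mul2 mulzK. Qed.

Lemma even_vec_mul2 k : even_vec (k *+ 2).
Proof. by apply/forallP => j; rewrite mulmxnE mulz_mul2 dvdz_mull. Qed.

Lemma dotp_ofZ (K : comPzRingType) k q :
  dotp (ofZ K k) (ofZ K q) = (dotp k q)%:~R.
Proof. by rewrite /dotp rmorph_sum; apply: eq_bigr => j _; rewrite !mxE rmorphM. Qed.

Lemma dotpDl (K : comPzRingType) (x y z : 'cV[K]_g) :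
  dotp (x + y) z = dotp x z + dotp y z.
Proof. by rewrite -big_split; apply: eq_bigr => j _; rewrite mxE mulrDl. Qed.

Lemma dotpDr (K : comPzRingType) (x y z : 'cV[K]_g) :
  dotp x (y + z) = dotp x y + dotp x z.
Proof. by rewrite -big_split; apply: eq_bigr => j _; rewrite mxE mulrDr. Qed.

Lemma dotpZl (K : comPzRingType) (c : K) (x y : 'cV[K]_g) :
  dotp (c *: x) y = c * dotp x y.
Proof. by rewrite mulr_sumr; apply: eq_bigr => j _; rewrite mxE mulrA. Qed.

Lemma dotpZr (K : comPzRingType) (c : K) (x y : 'cV[K]_g) :
  dotp x (c *: y) = c * dotp x y.
Proof. by rewrite mulr_sumr; apply: eq_bigr => j _; rewrite mxE mulrCA. Qed.

(** The sign [(-1)^<k, q>], kept as an exponential so that it combines with the exponents of theta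
    terms. *)
Definition chi k q : R[i] := cexp (pi_i R * dotp (ofZ R[i] k) (ofZ R[i] q)).

Lemma chi_even k q m : chi k (q + m *+ 2) = chi k q.
Proof.
rewrite /chi !dotp_ofZ dotpDr -scaler_nat dotpZr intrD mulrDr cexpD.
by rewrite cexp_pi_even mulr1.
Qed.

Lemma chiD k m q : chi (k + m) q = chi k q * chi m q.
Proof. by rewrite /chi !dotp_ofZ dotpDl intrD mulrDr cexpD. Qed.

Lemma chi_mul2 k q : chi (k *+ 2) q = 1.
Proof. by rewrite /chi dotp_ofZ -scaler_nat dotpZl cexp_pi_even. Qed.

(** Entrywise parity is a bijection from any system of representatives to [{0,1}^g], and sums over
    the latter can be factored coordinate by coordinate. *)
Lemma sum_representatives_mod2 (V : nmodType) (Q : {fset 'cV[int]_g})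
    (F : 'cV[int]_g -> V) :
  representatives_mod2 Q -> (forall q m, F (q + m *+ 2) = F q) ->
  \sum_(q <- Q) F q =
  \sum_(s : {ffun 'I_g -> bool}) F (\col_j (s j : nat)%:Z).
Proof.
move=> Qrepr F2; pose e (s : {ffun 'I_g -> bool}) := \col_j (s j : nat)%:Z.
pose h k : {ffun 'I_g -> bool} := [ffun j => k j 0%R %% 2 == 1]%Z.
have hE k : k = e (h k) + half_vec k *+ 2.
  apply/colP => j; rewrite mxE mulmxnE !mxE ffunE [(k j 0%R %/ _)%Z *+ _]mulz_mul2.
  rewrite {1}(divz_eq (k j 0) 2) addrC; congr (_ + _).
  have := modz_ge0 (k j 0) (isT : 2 != 0 :> int).
  have := ltz_mod (k j 0) (isT : 2 != 0 :> int).
  by case: (k j 0%R %% 2)%Z => [[|[|n]]|[|n]].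
have hD s m : h (e s + m *+ 2) = s.
  apply/ffunP => j; rewrite ffunE mxE mulmxnE mxE mulz_mul2 addrC modzMDl.
  by case: (s j).
rewrite (eq_big_seq (fun q => F (e (h q)))) => [|q _]; last by rewrite [in LHS](hE q).
rewrite -(big_map h xpredT (fun s => F (e s))).
apply: perm_big; apply: uniq_perm.
(* Two representatives with the same parities both represent the class of [e (h x)], so uniqueness
   identifies them. *)
- rewrite map_inj_in_uniq ?fset_uniq// => x y xQ yQ xy.
  have [s [_ sU]] := Qrepr (e (h x)).
  have xN z : e (h z) = z + (- half_vec z) *+ 2 by rewrite {2}(hE z) mulNrn addrK.
  rewrite -(sU x) ?(sU y)//; split => //; last by exists (- half_vec x); rewrite {1}xN.
  by exists (- half_vec y); rewrite xy {1}xN.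
- exact: index_enum_uniq.
move=> s; rewrite mem_index_enum; apply/mapP.
have [q [[qQ [m sE]] _]] := Qrepr (e s); exists q => //.
rewrite -[LHS](hD s 0) mul0rn addr0 sE.
by rewrite (hE q) -addrA -mulrnDl !hD.
Qed.

(** Orthogonality of characters: over [{0,1}^g] the sum is the product over [j] of [1 + (-1)^(m_j)],
    where each factor is 2 or 0. *)
Lemma sum_chi (Q : {fset 'cV[int]_g}) m : representatives_mod2 Q ->
  \sum_(q <- Q) chi m q = 2 ^+ g * (even_vec m)%:R.
Proof.
move=> Qrepr; rewrite (sum_representatives_mod2 Qrepr (chi_even m)).
pose F (j : 'I_g) (b : bool) : R[i] := cexp (pi_i R * (m j 0 * (b : nat)%:Z)%:~R).
rewrite (eq_bigr (fun s : {ffun 'I_g -> bool} => \prod_j F j (s j))) => [|s _]; last first.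
  rewrite /chi dotp_ofZ /dotp rmorph_sum mulr_sumr cexp_sum.
  by apply: eq_bigr => j _; rewrite mxE.
rewrite -bigA_distr_bigA /=.
have FE j : \sum_b F j b = 2 * (2 %| m j 0%R)%Z%:R.
  rewrite big_bool /F /= !cexp_pi_int mulr1 mulr0 expr0 dvdzE /= dvdn2 -signr_odd.
  by case: (odd _); rewrite ?mulr0 ?mulr1 ?expr1 ?addNr.
under eq_bigr do rewrite FE.
rewrite big_split /= prodr_const card_ord; congr (_ * _).
have [/forallP m2|] := boolP (even_vec m).
  by rewrite big1 // => j _; rewrite m2.
by move=> /forallPn[j mj]; rewrite (bigD1 j) //= (negPf mj) mul0r.
Qed.

End Parity.

(** * Dual vectors *)

Lemma ord4P (P : 'I_4 -> Prop) : P 0 -> P 1 -> P 2 -> P 3 -> forall k, P k.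
Proof.
move=> P0 P1 P2 P3 [[|[|[|[|//]]]] lt4].
- by rewrite (_ : Ordinal lt4 = 0); last exact: val_inj.
- by rewrite (_ : Ordinal lt4 = 1); last exact: val_inj.
- by rewrite (_ : Ordinal lt4 = 2); last exact: val_inj.
- by rewrite (_ : Ordinal lt4 = 3); last exact: val_inj.
Qed.

Lemma big_ord4 (V : Type) (idx : V) (op : Monoid.law idx) (F : 'I_4 -> V) :
  \big[op/idx]_(k < 4) F k = op (op (F 0) (F 1)) (op (F 2) (F 3)).
Proof.
rewrite !big_ord_recl big_ord0 Monoid.mulm1 Monoid.mulmA.
by congr (op (op (F _) (F _)) (op (F _) (F _))); apply: val_inj.
Qed.

(** Quadruples are pairs of pairs, so that a product of four series arises from two levels of
    products of two. *)
Definition quad (T : Type) (J : (T * T) * (T * T)) (k : 'I_4) : T :=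
  tnth [tuple J.1.1; J.1.2; J.2.1; J.2.2] k.

Lemma jacobi_dualE (K : unitRingType) (V : lmodType K) (x : 'I_4 -> V) :
  (jacobi_dual x 0 = 2^-1 *: (x 0 + x 1 + x 2 + x 3)) *
  (jacobi_dual x 1 = 2^-1 *: (x 0 + x 1 - x 2 - x 3)) *
  (jacobi_dual x 2 = 2^-1 *: (x 0 - x 1 + x 2 - x 3)) *
  (jacobi_dual x 3 = 2^-1 *: (x 0 - x 1 - x 2 + x 3)).
Proof. by []. Qed.

Lemma ww_dualE (K : unitRingType) (V : lmodType K) (x : 'I_4 -> V) :
  (ww_dual x 0 = 2^-1 *: (- x 0 + x 1 + x 2 + x 3)) *
  (ww_dual x 1 = 2^-1 *: (x 0 - x 1 + x 2 + x 3)) *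
  (ww_dual x 2 = 2^-1 *: (x 0 + x 1 - x 2 + x 3)) *
  (ww_dual x 3 = 2^-1 *: (x 0 + x 1 + x 2 - x 3)).
Proof. by []. Qed.

(** With [s] half the sum of the four vectors, the Whittaker-Watson dual of [x k] is [s - x k]. The
    three combinations of zero coefficient sum lose [s] and change sign; the half-sum becomes
    [2s - s = s]. *)
Lemma jacobi_dual_ww_dual (K : numFieldType) (g : nat) (x : 'I_4 -> 'cV[K]_g) k :
  jacobi_dual (ww_dual x) k = (if k == 0 then 1 else -1) *: jacobi_dual x k.
Proof.
by move: k; apply: ord4P; apply/colP => j; rewrite !jacobi_dualE !ww_dualE /= !mxE; field.
Qed.

Lemma jacobi_dualD (K : unitRingType) (V : lmodType K) (x y : 'I_4 -> V) k :
  jacobi_dual (fun l => x l + y l) k = jacobi_dual x k + jacobi_dual y k.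
Proof.
by move: k; apply: ord4P; rewrite !jacobi_dualE -scalerDr; congr (_ *: _);
  rewrite ?opprD; do ?[rewrite [in RHS]addrACA; congr (_ + _)].
Qed.

Lemma jacobi_dual_toC (R : realType) (g : nat) (x : 'I_4 -> 'cV[R]_g) k :
  jacobi_dual (fun l => toC (x l)) k = toC (jacobi_dual x k).
Proof.
by move: k; apply: ord4P; rewrite !jacobi_dualE; apply/colP => j; rewrite !mxE
  rmorphM fmorphV rmorph_nat ?(rmorphD, rmorphN, rmorphB).
Qed.

(** Orthogonality of the matrix of the Jacobi dual, for scalars. Quadratic forms and scalar products
    of vectors reduce to it for each fixed choice of coordinates. *)
Lemma sum_jacobi_dual (K : numFieldType) (x y : 'I_4 -> K) :
  \sum_(k < 4) jacobi_dual (V := K^o) x k * jacobi_dual (V := K^o) y k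
  = \sum_(k < 4) x k * y k.
Proof. by rewrite !big_ord4 /= !jacobi_dualE /GRing.scale /=; field. Qed.

Lemma jacobi_dual_entry (K : unitRingType) (g : nat) (x : 'I_4 -> 'cV[K]_g) k j :
  jacobi_dual x k j 0 = jacobi_dual (V := K^o) (fun l => x l j 0) k.
Proof. by move: k; apply: ord4P; rewrite !jacobi_dualE !mxE. Qed.

(** * Theta functions *)

Lemma sum_jacobi_dual_quadratic (K : numFieldType) (g : nat) (A : 'M[K]_g)
    (x : 'I_4 -> 'cV[K]_g) :
  \sum_(k < 4) dotp (A *m jacobi_dual x k) (jacobi_dual x k) =
  \sum_(k < 4) dotp (A *m x k) (x k).
Proof.
under eq_bigr do rewrite dotpE; under [RHS]eq_bigr do rewrite dotpE.
rewrite exchange_big [RHS]exchange_big; apply: eq_bigr => i _.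
rewrite exchange_big [RHS]exchange_big; apply: eq_bigr => j _ /=.
under eq_bigr do rewrite -mulrA !jacobi_dual_entry.
by rewrite -mulr_sumr sum_jacobi_dual mulr_sumr; apply: eq_bigr => k _; rewrite mulrA.
Qed.

Lemma sum_jacobi_dual_dotp (K : numFieldType) (g : nat)
    (x w : 'I_4 -> 'cV[K]_g) :
  \sum_(k < 4) dotp (jacobi_dual x k) (jacobi_dual w k) =
  \sum_(k < 4) dotp (x k) (w k).
Proof.
rewrite exchange_big [RHS]exchange_big; apply: eq_bigr => j _ /=.
by under eq_bigr do rewrite !jacobi_dual_entry; rewrite sum_jacobi_dual.
Qed.

Lemma has_sum_quad (R : realType) (I : choiceType) (f : 'I_4 -> I -> R[i])
    (s : 'I_4 -> R[i]) :
  (forall k, abs_summable (f k)) ->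
  (forall k, has_sum (f k : I -> R[i]^o) (s k)) ->
  has_sum ((fun J : (I * I) * (I * I) => \prod_(k < 4) f k (quad J k)) : _ -> R[i]^o)
    (\prod_(k < 4) s k).
Proof.
move=> fa fs; rewrite big_ord4 /=.
have := has_sumM (abs_summableM (fa 0) (fa 1)) (abs_summableM (fa 2) (fa 3))
  (has_sumM (fa 0) (fa 1) (fs 0) (fs 1)) (has_sumM (fa 2) (fa 3) (fs 2) (fs 3)).
by apply: has_sum_ext => J; rewrite big_ord4.
Qed.

Section Theta.
Context {R : realType} {g : nat}.
Variable tau : 'M[R[i]]_g.
Implicit Types (x : 'cV[R]_g) (w : 'cV[R[i]]_g) (p q : 'cV[int]_g).

(** The product is the exponential of a sum of quadratic forms and scalar products over [k], and
    orthogonality preserves both sums. *)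
Lemma prod_theta_term_jacobi_dual (x : 'I_4 -> 'cV[R]_g) (w : 'I_4 -> 'cV[R[i]]_g) :
  \prod_(k < 4) theta_term tau (jacobi_dual x k) (jacobi_dual w k) =
  \prod_(k < 4) theta_term tau (x k) (w k).
Proof.
have expE (y v : 'I_4 -> 'cV[R[i]]_g) :
    \prod_(k < 4) cexp (pi_i R * dotp (tau *m y k) (y k) +
                         2 * pi_i R * dotp (y k) (v k)) =
    cexp (pi_i R * \sum_(k < 4) dotp (tau *m y k) (y k) +
          2 * pi_i R * \sum_(k < 4) dotp (y k) (v k)).
  by rewrite -cexp_sum big_split -!mulr_sumr.
pose y l := toC (x l).
transitivity (\prod_(k < 4) cexp
    (pi_i R * dotp (tau *m jacobi_dual y k) (jacobi_dual y k) +
     2 * pi_i R * dotp (jacobi_dual y k) (jacobi_dual w k))).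
  by apply: eq_bigr => k _; rewrite jacobi_dual_toC.
rewrite (expE (jacobi_dual y) (jacobi_dual w)).
transitivity (cexp (pi_i R * \sum_(k < 4) dotp (tau *m y k) (y k) +
                    2 * pi_i R * \sum_(k < 4) dotp (y k) (w k))).
  exact: (congr2 (fun s t => cexp (pi_i R * s + 2 * pi_i R * t))
    (sum_jacobi_dual_quadratic tau y) (sum_jacobi_dual_dotp y w)).
by rewrite -(expE y w).
Qed.

Lemma theta_termDr x w (v : 'cV[R[i]]_g) :
  theta_term tau x (w + v) = theta_term tau x w * cexp (2 * pi_i R * dotp (toC x) v).
Proof. by rewrite /theta_term dotpDr mulrDr addrA cexpD. Qed.

Lemma theta_termNN x w : theta_term tau (- x) (- w) = theta_term tau x w.
Proof.
rewrite /theta_term.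
have -> : toC (- x) = (- 1) *: toC x.
  by apply/colP => j; rewrite !mxE rmorphN mulN1r.
rewrite -[- w]scaleN1r -scalemxAr !dotpZl !dotpZr; congr cexp; ring.
Qed.

Lemma toCD x y : toC (x + y) = toC x + toC y.
Proof. exact: raddfD. Qed.

Lemma toCZ (c : R) x : toC (c *: x) = c%:C *: toC x.
Proof. by apply/colP => j; rewrite !mxE rmorphM. Qed.

Lemma toCN x : toC (- x) = - toC x.
Proof. exact: raddfN. Qed.

Lemma toC_ofZ p : toC (ofZ R p) = ofZ R[i] p.
Proof. by apply/colP => j; rewrite !mxE rmorph_int. Qed.

Lemma half_toC : (2^-1 : R)%:C = 2^-1.
Proof. by rewrite fmorphV rmorph_nat. Qed.

(** Adding [q/2] to [b] multiplies the term by [e^(pi i <k + a + p/2, q>)]. The prefactor cancels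
    the part in [a], leaving a character of [k] and a constant. *)
Lemma theta_shift a b u k p q :
  cexp (- (pi_i R * dotp (toC a) (ofZ R[i] q))) *
    theta_term tau (ofZ R k + (a + 2^-1 *: ofZ R p)) (u + toC (b + 2^-1 *: ofZ R q)) =
  chi k q * cexp (pi_i R * 2^-1 * dotp (ofZ R[i] p) (ofZ R[i] q)) *
  theta_term tau (ofZ R k + 2^-1 *: ofZ R p + a) (u + toC b).
Proof.
rewrite toCD [u + _]addrA (theta_termDr _ (u + toC b)).
rewrite [a + _]addrC [ofZ R k + _]addrA mulrCA [RHS]mulrC; congr (_ * _).
rewrite /chi -!cexpD; congr cexp.
rewrite !(toCD, toCZ) !toC_ofZ half_toC !dotpZr !dotpDl !dotpZl.
by field.
Qed.

Hypothesis tau_pos : posdef (map_mx (fun z : R[i] => complex.Im z) tau).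

(** The limit that defines [theta] exists, so it may be manipulated as a genuine sum. *)
Lemma theta_has_sum a b (u : 'cV[R[i]]_g) :
  has_sum ((fun k : 'cV[int]_g => theta_term tau (ofZ R k + a) (u + toC b)) : _ -> R[i]^o)
    (theta a b u tau).
Proof.
have [s fs] := abs_summable_has_sum (theta_term_abs_summable a (u + toC b) tau_pos).
by rewrite /theta (has_sum_sum fs).
Qed.

Lemma theta_parity a b u p q :
  cexp (- (pi_i R * dotp (toC (- a)) (ofZ R[i] q))) *
    theta (- a + 2^-1 *: ofZ R p) (- b + 2^-1 *: ofZ R q) (- u) tau =
  cexp (- (pi_i R * dotp (ofZ R[i] p) (ofZ R[i] q))) *
    (cexp (- (pi_i R * dotp (toC a) (ofZ R[i] q))) *
     theta (a + 2^-1 *: ofZ R p) (b + 2^-1 *: ofZ R q) u tau).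
Proof.
apply: (@has_sum_unique _ R[i]^o 'cV[int]_g); last first.
  by do 2 apply: has_sumZ; exact: theta_has_sum.
(* Chosen so that [phi k + p/2 - a = - (k + p/2 + a)]; evenness of the term in the pair of its
   arguments then applies. *)
pose phi k := - k - p.
have phiK : involutive phi by move=> k; rewrite /phi opprB opprK addrAC subrr add0r.
have termE k :
  cexp (- (pi_i R * dotp (toC (- a)) (ofZ R[i] q))) *
    theta_term tau (ofZ R (phi k) + (- a + 2^-1 *: ofZ R p))
      (- u + toC (- b + 2^-1 *: ofZ R q)) =
  cexp (- (pi_i R * dotp (ofZ R[i] p) (ofZ R[i] q))) *
    (cexp (- (pi_i R * dotp (toC a) (ofZ R[i] q))) *
     theta_term tau (ofZ R k + (a + 2^-1 *: ofZ R p)) (u + toC (b + 2^-1 *: ofZ R q))).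
  rewrite [LHS]theta_shift [X in _ = _ * X]theta_shift [RHS]mulrA.
  congr (_ * _).
    rewrite [RHS]mulrA; congr (_ * _).
    (* Characters ignore even vectors, so [-k] may be replaced by [k]; the remaining [-p] yields the
       factor [e^(- pi i <p, q>)]. *)
    rewrite /phi (_ : - k - p = k + - p + (- k) *+ 2); last first.
      by rewrite mulr2n addrAC addrA subrr add0r.
    rewrite chiD chi_mul2 mulr1 chiD mulrC /chi; congr (cexp _ * _).
    by rewrite !dotp_ofZ -scaleN1r dotpZl mulN1r mulrNz mulrN.
  have -> : ofZ R (phi k) + 2^-1 *: ofZ R p - a = - (ofZ R k + 2^-1 *: ofZ R p + a).
    by apply/colP => j; rewrite !mxE rmorphB rmorphN /=; field.
  by rewrite toCN -opprD; exact: theta_termNN.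
apply: (has_sum_reindex (phi := phi) (psi := phi)); last first.
- by apply: has_sumZ; exact: theta_has_sum.
- by move=> k _; rewrite phiK; split => //; exact: termE.
- by move=> k _; rewrite phiK; split => //; rewrite -[in RHS](phiK k); apply/esym/termE.
Qed.

End Theta.

(** * Jacobi's identity *)

Section JacobiIdentity.
Context {R : realType} {g : nat}.
Implicit Types (p q : 'cV[int]_g).

Definition quads : choiceType :=
  (('cV[int]_g * 'cV[int]_g) * ('cV[int]_g * 'cV[int]_g))%type.
Implicit Types (J N : quads).

Definition quad_sum J : 'cV[int]_g := \sum_(k < 4) quad J k.

Lemma quad_sumE J : quad_sum J = J.1.1 + J.1.2 + (J.2.1 + J.2.2).
Proof. by rewrite /quad_sum big_ord4. Qed.

(* [A (J + p/2)], with [A] the matrix of the Jacobi dual; integral when the sum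
   of [J] is even. *)
Definition to_dual p J : quads :=
  let h := half_vec (quad_sum J) in
  ((h + p, h - J.2.1 - J.2.2), (h - J.1.2 - J.2.2, h - J.1.2 - J.2.1)).

(* [A N - p/2], the inverse of [to_dual p]. *)
Definition of_dual p N : quads :=
  let h := half_vec (quad_sum N - p) in
  ((h, h - N.2.1 - N.2.2), (h - N.1.2 - N.2.2, h - N.1.2 - N.2.1)).

(** The dual of the constant quadruple [p/2] is [(p, 0, 0, 0)], so [p] enters only the first
    component. *)
Lemma to_dualP p J : even_vec (quad_sum J) ->
  [/\ even_vec (quad_sum (to_dual p J) - p), of_dual p (to_dual p J) = J &
      forall k, jacobi_dual (fun l => ofZ R (quad (to_dual p J) l)) k =
                ofZ R (quad J k) + 2^-1 *: ofZ R p].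
Proof.
case: J => -[j0 j1] [j2 j3] /half_vecK.
rewrite /of_dual /to_dual; set h := half_vec _; rewrite quad_sumE /= => hE.
have {hE} -> : j0 = h *+ 2 - j1 - (j2 + j3) by rewrite hE addrAC !addrK.
(* The entries of a dual quadruple add up to twice the first original entry, here [2 (j0 + p/2)];
   removing [p] leaves [2 j0]. *)
have sE : quad_sum ((h + p, h - j2 - j3), (h - j1 - j3, h - j1 - j2)) - p =
    (h *+ 2 - j1 - (j2 + j3)) *+ 2.
  by rewrite quad_sumE /=; apply/colP => j; rewrite !mxE; ring.
rewrite sE mul2_half_vec even_vec_mul2; split => //.
  by congr ((_, _), (_, _)); apply/colP => j; rewrite !mxE; ring.
by apply: ord4P; rewrite jacobi_dualE /quad /=; apply/colP => j; rewrite !mxE; field.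
Qed.

Lemma of_dualP p N : even_vec (quad_sum N - p) ->
  [/\ even_vec (quad_sum (of_dual p N)), to_dual p (of_dual p N) = N &
      forall k, jacobi_dual (fun l => ofZ R (quad N l)) k =
                ofZ R (quad (of_dual p N) k) + 2^-1 *: ofZ R p].
Proof.
move=> N2; have [J2 NE] : even_vec (quad_sum (of_dual p N)) /\ to_dual p (of_dual p N) = N.
  case: N N2 => -[n0 n1] [n2 n3] /half_vecK.
  rewrite /of_dual /to_dual; set h := half_vec _; rewrite quad_sumE /= => hE.
  have {hE} -> : n0 = h *+ 2 + p - n1 - (n2 + n3) by rewrite hE subrK addrAC !addrK.
  have -> : quad_sum ((h, h - n2 - n3), (h - n1 - n3, h - n1 - n2)) =
      (h *+ 2 - n1 - n2 - n3) *+ 2.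
    by rewrite quad_sumE /=; apply/colP => j; rewrite !mxE; ring.
  rewrite mul2_half_vec even_vec_mul2; split => //.
  by congr ((_, _), (_, _)); apply/colP => j; rewrite !mxE; ring.
by split=> //; have [_ _] := to_dualP p J2; rewrite NE.
Qed.

Lemma chi_quad_sum J q : chi (quad_sum J) q = \prod_(k < 4) chi (quad J k) q :> R[i].
Proof.
apply: (big_morph (fun k => chi k q)) => [k m|]; first exact: chiD.
by rewrite -(mul0rn _ 2) chi_mul2.
Qed.

Variable tau : 'M[R[i]]_g.
Hypothesis tau_pos : posdef (map_mx (fun z : R[i] => complex.Im z) tau).
Variables (a b : 'I_4 -> 'cV[R]_g) (u : 'I_4 -> 'cV[R[i]]_g).

(** The term shared by the two expansions: [x] is [J + p/2] in the dual products and the dual of [N]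
    in the original product. *)
Let summand (x : 'I_4 -> 'cV[R]_g) : R[i] :=
  \prod_(k < 4) theta_term tau (x k + jacobi_dual a k)
    (jacobi_dual u k + toC (jacobi_dual b k)).

Let dual_prod p q : R[i] :=
  \prod_(k < 4)
    (cexp (- (pi_i R * dotp (toC (jacobi_dual a k)) (ofZ R[i] q))) *
     theta (jacobi_dual a k + 2^-1 *: ofZ R p)
           (jacobi_dual b k + 2^-1 *: ofZ R q) (jacobi_dual u k) tau).

(** Each of the four factors contributes a character and the constant [e^(pi i <p, q> / 2)]. The
    characters multiply to that of the sum of [J], and the constants to [e^(2 pi i <p, q>) = 1]. *)
Lemma dual_prod_has_sum p q :
  has_sum ((fun J => chi (quad_sum J) q *
     summand (fun k => ofZ R (quad J k) + 2^-1 *: ofZ R p)) : quads -> R[i]^o)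
    (dual_prod p q).
Proof.
pose f k n : R[i] := cexp (- (pi_i R * dotp (toC (jacobi_dual a k)) (ofZ R[i] q))) *
  theta_term tau (ofZ R n + (jacobi_dual a k + 2^-1 *: ofZ R p))
    (jacobi_dual u k + toC (jacobi_dual b k + 2^-1 *: ofZ R q)).
have fa k : abs_summable (f k).
  by apply: abs_summableZ; exact: theta_term_abs_summable.
have fs k : has_sum (f k : _ -> R[i]^o)
    (cexp (- (pi_i R * dotp (toC (jacobi_dual a k)) (ofZ R[i] q))) *
     theta (jacobi_dual a k + 2^-1 *: ofZ R p)
       (jacobi_dual b k + 2^-1 *: ofZ R q) (jacobi_dual u k) tau).
  by apply: has_sum_mull; exact: theta_has_sum.
have := has_sum_quad fa fs.
apply: has_sum_ext => J.
rewrite (eq_bigr _ (fun k _ => theta_shift _ _ _ _ _ _ _)) big_split big_split /=.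
rewrite -chi_quad_sum; congr (_ * _); rewrite -[RHS]mulr1; congr (_ * _).
rewrite -cexp_sum sumr_const card_ord -[RHS](cexp_pi_even (dotp p q)); congr cexp.
by rewrite dotp_ofZ intrM; field.
Qed.

Lemma prod_theta_has_sum :
  has_sum ((fun N => summand (jacobi_dual (fun k => ofZ R (quad N k)))) : quads -> R[i]^o)
    (\prod_(k < 4) theta (a k) (b k) (u k) tau).
Proof.
have fs k := @theta_has_sum R g tau tau_pos (a k) (b k) (u k).
have := has_sum_quad (fun k => theta_term_abs_summable (a k) _ tau_pos) fs.
apply: has_sum_ext => N; rewrite -prod_theta_term_jacobi_dual.
apply: eq_bigr => k _; rewrite (jacobi_dualD _ a) (jacobi_dualD u).
by rewrite (jacobi_dual_toC b).
Qed.

Lemma jacobi_identity (P Q : {fset 'cV[int]_g}) :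
  representatives_mod2 P -> representatives_mod2 Q ->
  \prod_(k < 4) theta (a k) (b k) (u k) tau =
  2 ^- g * \sum_(p <- P) \sum_(q <- Q) dual_prod p q.
Proof.
move=> P_repr Q_repr; apply: (has_sum_unique prod_theta_has_sum).
rewrite mulr_sumr.
(* For fixed [p], summation over [q] keeps the [J] of even sum; in terms of [N] these are the
   quadruples whose sum is congruent to [p] modulo 2. *)
have pE p : has_sum ((fun N => (even_vec (quad_sum N - p))%:R *
    summand (jacobi_dual (fun k => ofZ R (quad N k)))) : quads -> R[i]^o)
    (2 ^- g * \sum_(q <- Q) dual_prod p q).
  apply: (@has_sum_reindex _ R[i]^o quads quads (fun J => (even_vec (quad_sum J))%:R *
    summand (fun k => ofZ R (quad J k) + 2^-1 *: ofZ R p)) _ (to_dual p) (of_dual p)).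
  - move=> J; have [J2 _|_] := boolP (even_vec (quad_sum J)); last by rewrite mul0r eqxx.
    have [N2 JK jE] := to_dualP p J2; split; last exact: JK.
    exact: (congr2 (fun (e : bool) (z : R[i]) => e%:R * z) N2
      (congr1 summand (funext jE))).
  - move=> N; have [N2 _|_] := boolP (even_vec (quad_sum N - p)); last by rewrite mul0r eqxx.
    have [J2 NK nE] := of_dualP N2; split; last exact: NK.
    exact: (congr2 (fun (e : bool) (z : R[i]) => e%:R * z) J2
      (congr1 summand (esym (funext nE)))).
  (* Orthogonality of characters turns the sum over [q] into [2^g] times the indicator of an even
     sum, and [2^-g] cancels the power. *)
  have := @has_sum_mull R quads (2 ^- g) _ _ (has_sum_big (r := Q) (@dual_prod_has_sum p)).
  apply: has_sum_ext => J; rewrite -mulr_suml (sum_chi _ Q_repr).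
  rewrite /GRing.scale /= !mulrA mulVf ?mul1r// expf_neq0 // pnatr_eq0.
have := has_sum_big (r := P) pE; apply: has_sum_ext => N.
rewrite -mulr_suml -[RHS]mul1r; congr (_ * _).
(* The sum of [N] is congruent to exactly one [s] in [P], so each [N] is counted once as [p]
   varies. *)
have [s [[sP [m sN]] sU]] := P_repr (quad_sum N).
have even_s : even_vec (quad_sum N - s).
  by rewrite sN addrAC subrr add0r even_vec_mul2.
rewrite (big_rem s) //= even_s big_seq big1 ?addr0 // => p pP.
have [p2|//] := boolP (even_vec _).
have ps : s = p.
  apply: sU; split; first exact: mem_rem pP.
  by exists (half_vec (quad_sum N - p)); rewrite half_vecK // addrC subrK.
by move: pP; rewrite -ps mem_rem_uniqF ?fset_uniq.
Qed.

End JacobiIdentity.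

(** * Difference of the two Jacobi identities *)

Theorem mainTheorem2 (R : realType) (g : nat) (tau : 'M[R[i]]_g)
    (tau_sym : tau^T = tau)
    (tau_pos : posdef (map_mx (fun z : R[i] => complex.Im z) tau))
    (a b : 'I_4 -> 'cV[R]_g) (u : 'I_4 -> 'cV[R[i]]_g)
    (P Q : {fset 'cV[int]_g})
    (P_repr : representatives_mod2 P) (Q_repr : representatives_mod2 Q) :
  \prod_(k < 4) theta (a k) (b k) (u k) tau
  - \prod_(k < 4) theta (ww_dual a k) (ww_dual b k) (ww_dual u k) tau
  = 2 ^- g * \sum_(p <- P) \sum_(q <- Q)
      (1 - cexp (- (pi_i R * dotp (ofZ R[i] p) (ofZ R[i] q)))) *
      \prod_(k < 4)
        (cexp (- (pi_i R * dotp (toC (jacobi_dual a k)) (ofZ R[i] q))) *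
         theta (jacobi_dual a k + 2^-1 *: ofZ R p)
               (jacobi_dual b k + 2^-1 *: ofZ R q)
               (jacobi_dual u k) tau).
Proof.
rewrite [X in X - _](jacobi_identity tau_pos a b u P_repr Q_repr).
rewrite [X in _ - X](jacobi_identity tau_pos _ _ _ P_repr Q_repr).
rewrite -mulrBr -sumrB; congr (_ * _); apply: eq_bigr => p _.
rewrite -sumrB; apply: eq_bigr => q _; rewrite mulrBl mul1r; congr (_ - _).
pose c := cexp (- (pi_i R * dotp (ofZ R[i] p) (ofZ R[i] q))).
pose F (k : 'I_4) : R[i] :=
  cexp (- (pi_i R * dotp (toC (jacobi_dual a k)) (ofZ R[i] q))) *
  theta (jacobi_dual a k + 2^-1 *: ofZ R p)
    (jacobi_dual b k + 2^-1 *: ofZ R q) (jacobi_dual u k) tau.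
have c2 : c * c = 1.
  rewrite /c -cexpD dotp_ofZ -[RHS](cexp_pi_even (- dotp p q)); congr cexp.
  by rewrite rmorphM rmorphN /=; ring.
(* The three indices other than 0 carry a sign change of the dual vectors, hence a factor [c] each,
   and [c^3 = c]. *)
transitivity (\prod_(k < 4) ((if k == 0 then 1 else c) * F k)).
  apply: eq_bigr => k _; rewrite !jacobi_dual_ww_dual.
  case: ifP => _; first by rewrite !scale1r mul1r.
  by rewrite !scaleN1r; exact: theta_parity.
by rewrite big_split big_ord4 /= mul1r c2 mulr1.
Qed.
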